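(* For every positive integer $n$ and every positive integer $m$ divisible by $3$, there exists a generalized bent function $f:\mathbb{Z}_3^n\to\mathbb{Z}_m$.
   Context: A function $f:G\to\mathbb{Z}_m$ on a finite abelian group $G$ is a generalized bent function if $\left|\sum_{x\in G}\zeta_m^{f(x)}\chi(x)\right|^2=|G|$ for every character $\chi$ of $G$, where $\zeta_m$ is a primitive $m$-th root of unity. *)

(* Defs.v *)
From HB Require Import structures.
From mathcomp Require Import all_boot all_order all_algebra.
From mathcomp Require Import all_fingroup all_solvable all_field all_character.

Set Implicit Arguments.
Unset Strict Implicit.
Unset Printing Implicit Defensive.

Import GRing.Theory Num.Theory.

Local Open Scope ring_scope.

(* The characters of a finite abelian group are the homomorphisms into the    *)
(* nonzero complex numbers, i.e. the linear characters; their values, like    *)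
(* zeta, are roots of unity, so algC is the appropriate field of scalars.     *)
(* The condition does not depend on which primitive m-th root of unity zeta   *)
(* is used (at least one exists in algC when m > 0).  Only use with m > 1, as *)
(* 'Z_m is not Z/mZ otherwise.                                                *)
Definition generalized_bent (A : finZmodType) (m : nat) (f : A -> 'Z_m) : Prop :=
  forall zeta : algC, m.-primitive_root zeta ->
  forall chi : 'CF([set: A]), chi \is a linear_char ->
    `|\sum_(x : A) zeta ^+ f x * chi x| ^+ 2 = #|A|%:R.

(* Main.v *)
Require Import Defs.
From mathcomp Require Import all_boot all_order all_algebra.
From mathcomp Require Import all_fingroup all_solvable all_field all_character.

Set Implicit Arguments.
Unset Strict Implicit.
Unset Printing Implicit Defensive.

(** The function [f x = (m / 3) q x], with [q x = \sum_i x_i ^ 2] over Z_3, is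
    generalized bent.  Put [w = zeta ^ (m / 3)], a primitive cube root of unity.
    Substituting [x = y + z] in the squared modulus of the character sum [S],
    the polarization [q (y + z) = q y + q z + 2 y.z] gives
    [|S| ^ 2 = \sum_z w ^ (q z) chi z \sum_y w ^ (2 y.z)], where the inner sum
    is that of an additive character of y, nontrivial unless z = 0; only the
    term [z = 0], equal to the order of the group, survives. *)

Import GRing.Theory Num.Theory.
Local Open Scope ring_scope.

(** Translation by [a] permutes the group, so the sum equals [c] times itself. *)
Lemma sum_shift_eq0 (A : finZmodType) (F : A -> algC) (a : A) (c : algC) :
  c != 1 -> (forall y, F (y + a) = c * F y) -> \sum_y F y = 0.
Proof.
move=> c_neq1 shiftF; apply/eqP.
have: (c - 1) * \sum_y F y == 0.
  rewrite mulrBl mul1r subr_eq0 mulr_sumr [eqbRHS](reindex_inj (addIr a)) /=.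
  by apply/eqP/eq_bigr => y _; rewrite shiftF.
by rewrite mulf_eq0 subr_eq0 (negPf c_neq1).
Qed.

Section AdditiveCharacter.

Variables (w : algC) (p : nat).
Hypotheses (p_gt1 : (1 < p)%N) (prim_w : p.-primitive_root w).

Lemma expr_Zp_add (a b : 'Z_p) : w ^+ (a + b)%R = w ^+ a * w ^+ b.
Proof.
(* Addition in ['Z_p] reduces representatives modulo [p], which is harmless since [w ^+ p = 1]. *)
rewrite -exprD -[RHS](prim_expr_mod prim_w).
by congr (w ^+ (_ %% _)%N); rewrite Zp_cast.
Qed.

Lemma expr_Zp_eq1 (a : 'Z_p) : (w ^+ a == 1) = (a == 0).
Proof.
rewrite -(prim_order_dvd prim_w) -val_eqE /= /dvdn modn_small //.
by rewrite -[ltnRHS]Zp_cast.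
Qed.

End AdditiveCharacter.

Lemma norm_prim_rootX (k : nat) (w : algC) (i : nat) :
  k.-primitive_root w -> `|w ^+ i| = 1.
Proof.
move=> prim_w; have k_gt0 := prim_order_gt0 prim_w.
have /eqP norm_w : `|w| == 1.
  by rewrite -(pexpr_eq1 k_gt0) // -normrX (prim_expr_order prim_w) normr1.
by rewrite normrX norm_w expr1n.
Qed.

Lemma lin_char_addM (A : finZmodType) (chi : 'CF([set: A])) (x y : A) :
  chi \is a linear_char -> chi (x + y) = chi x * chi y.
Proof. by move=> lin_chi; rewrite -FinRing.zmodMgE lin_charM ?inE. Qed.

Section Z3SumOfSquares.

Variable n : nat.
Implicit Types x y z : 'rV['Z_3]_n.

Definition dotZ3 x y : 'Z_3 := (x *m y^T) 0 0.
Definition sqZ3 x : 'Z_3 := dotZ3 x x.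

Lemma dotZ3_Dl x y z : dotZ3 (x + y) z = dotZ3 x z + dotZ3 y z.
Proof. by rewrite /dotZ3 mulmxDl mxE. Qed.

Lemma dotZ3C x y : dotZ3 x y = dotZ3 y x.
Proof. by rewrite /dotZ3 !mxE; apply: eq_bigr => i _; rewrite !mxE mulrC. Qed.

Lemma dotZ3_delta z i : dotZ3 (delta_mx 0 i) z = z 0 i.
Proof. by rewrite /dotZ3 -rowE !mxE. Qed.

Lemma sqZ3D y z : sqZ3 (y + z) = sqZ3 y + (sqZ3 z + dotZ3 y z *+ 2).
Proof.
rewrite /sqZ3 dotZ3_Dl ![dotZ3 _ (y + z)]dotZ3C !dotZ3_Dl (dotZ3C z y).
by rewrite mulr2n -addrA; congr (_ + _); rewrite addrA addrC.
Qed.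

(** Shifting [y] by a basis vector at a nonzero coordinate of [z] multiplies each term by a constant
    other than 1. *)
Lemma sum_expr_dotZ3 (w : algC) z : 3.-primitive_root w -> z != 0 ->
  \sum_y w ^+ (dotZ3 y z *+ 2)%R = 0.
Proof.
move=> prim_w z_neq0.
have [i zi_neq0]: exists i, z 0 i != 0.
  apply/existsP; apply: contraNT z_neq0; rewrite negb_exists => /forallP z0.
  by apply/eqP/rowP => i; rewrite mxE; apply/eqP; move: (z0 i); rewrite negbK.
apply: (@sum_shift_eq0 _ _ (delta_mx 0 i) (w ^+ (z 0 i *+ 2)%R)).
  rewrite expr_Zp_eq1 //.
  (* Doubling is injective modulo 3. *)
  by case: (z 0 i) zi_neq0 => [[|[|[|]]] ?].
by move=> y; rewrite dotZ3_Dl dotZ3_delta mulrnDl (expr_Zp_add _ prim_w) // mulrC.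
Qed.

Lemma normC_sum_sqZ3 (w : algC) (chi : 'CF([set: 'rV['Z_3]_n])) :
  3.-primitive_root w -> chi \is a linear_char ->
  `|\sum_x w ^+ (sqZ3 x) * chi x| ^+ 2 = #|{: 'rV['Z_3]_n}|%:R.
Proof.
move=> prim_w lin_chi; set S := \sum_x _.
have -> : `|S| ^+ 2 =
    \sum_z w ^+ (sqZ3 z) * chi z * \sum_y w ^+ (dotZ3 y z *+ 2)%R.
  rewrite normCK /S rmorph_sum mulr_sumr /=.
  under [RHS]eq_bigr do rewrite mulr_sumr.
  rewrite [RHS]exchange_big; apply: eq_bigr => y _.
  (* Here [y] indexes the conjugated factor, and [x = y + z] is substituted in the other one. *)
  rewrite mulr_suml (reindex_inj (addrI y)) /=; apply: eq_bigr => z _.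
  rewrite lin_char_addM // sqZ3D 2?(expr_Zp_add _ prim_w) //.
  set u := w ^+ sqZ3 y; set v := chi y.
  (* The factors depending on [y] alone have modulus 1 and cancel against the conjugate. *)
  have uv1 : (u * v) * (u * v)^* = 1.
    rewrite -normCK normrM (norm_prim_rootX _ prim_w) normC_lin_char ?inE //.
    by rewrite mulr1 expr1n.
  rewrite -[RHS]mul1r -uv1 -!mulrA; congr (u * _).
  set s := w ^+ sqZ3 z; set d := w ^+ _; set c := (_ * _)^*.
  rewrite [d * (v * _)]mulrCA [s * (v * _)]mulrCA; congr (v * _).
  by rewrite [RHS]mulrC -!mulrA; congr (s * _); rewrite mulrCA.
rewrite (bigD1 0) //= [X in _ + X]big1 => [|z z_neq0]; last first.
  by rewrite sum_expr_dotZ3 ?mulr0.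
have dot0 y : dotZ3 y 0 = 0 by rewrite /dotZ3 trmx0 mulmx0 mxE.
rewrite /sqZ3 dot0 expr0 mul1r -(FinRing.zmod1gE 'rV['Z_3]_n) lin_char1 // mul1r addr0.
under eq_bigr do rewrite dot0 mul0rn expr0.
by rewrite sumr_const.
Qed.

End Z3SumOfSquares.

Local Close Scope ring_scope.

Theorem theorem2p15 (n m : nat) (hn : 0 < n) (hm : 0 < m) (h3 : 3 %| m) :
  exists f : 'rV['Z_3]_n -> 'Z_m, generalized_bent f.
Proof.
(* This makes ['Z_m] the genuine ring of integers modulo [m]. *)
have m_gt1 : 1 < m by apply: leq_trans (dvdn_leq hm h3).
exists (fun x => ((m %/ 3 * sqZ3 x)%N%:R)%R) => zeta prim_zeta chi lin_chi.
have prim_w : (3.-primitive_root (zeta ^+ (m %/ 3)))%R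
  by exact: dvdn_prim_root.
rewrite -(normC_sum_sqZ3 prim_w lin_chi); congr (`|_| ^+ 2)%R.
apply: eq_bigr => x _; congr (_ * _)%R.
(* The cast to ['Z_m] reduces the exponent modulo [m], which leaves the power of [zeta]
   unchanged. *)
by rewrite val_Zp_nat // (prim_expr_mod prim_zeta) exprM.
Qed.
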